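(* Let $R$ be a semi-local $\phi$-Prüfer ring (i.e. a $\phi$-Prüfer ring with only finitely many maximal ideals). Then $R$ is a $\phi$-Bézout ring.
   Context: All rings are commutative with nonzero identity. For a ring $R$, $\mathrm{Nil}(R)$ denotes the ideal of nilpotent elements, $Z(R)$ the set of zerodivisors and $T(R)$ the total quotient ring. A prime ideal $P$ of $R$ is called divided if it is comparable (under inclusion) to every ideal of $R$. $R$ is a $\phi$-ring if $\mathrm{Nil}(R)$ is a divided prime ideal of $R$. An ideal $I$ of $R$ is nonnil if $I \not\subseteq \mathrm{Nil}(R)$. For a $\phi$-ring $R$, let $\phi: T(R) \to R_{\mathrm{Nil}(R)}$ be the ring homomorphism $\phi(a/b) = a/b$ for $a\in R$, $b \in R\setminus Z(R)$; restricted to $R$ it is the ring homomorphism $x \mapsto x/1$, with image the ring $\phi(R)$. A nonnil ideal $I$ of a $\phi$-ring $R$ is $\phi$-invertible if $\phi(I)$ is an invertible ideal of $\phi(R)$, i.e. $\phi(I)\,\phi(I)^{-1} = \phi(R)$ where $\phi(I)^{-1} = \{x \in T(\phi(R)) : x\phi(I) \subseteq \phi(R)\}$. A $\phi$-ring $R$ is $\phi$-Prüfer if every finitely generated nonnil ideal of $R$ is $\phi$-invertible. A $\phi$-ring $R$ is $\phi$-Bézout if $\phi(I)$ is a principal ideal of $\phi(R)$ for every finitely generated nonnil ideal $I$ of $R$. *)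

(* Defs.v *)
From HB Require Import structures.
From mathcomp Require Import all_boot all_order all_algebra ring.
From mathcomp Require Import generic_quotient.
From mathcomp Require Import all_classical.

Set Implicit Arguments.
Unset Strict Implicit.
Unset Printing Implicit Defensive.

Import GRing.Theory.
Local Open Scope quotient_scope.
Local Open Scope classical_set_scope.
Local Open Scope ring_scope.

(* Ideals are classical sets, and R itself is an ideal: [idealr_closed] of      *)
(* ring_quotient also requires properness, so it cannot be used for an          *)
(* arbitrary ideal.                                                             *)
Section Ideals.
Variable R : comNzRingType.
Implicit Types I P M : set R.

Definition ideal I :=
  [/\ I 0, forall x y, I x -> I y -> I (x + y) & forall a x, I x -> I (a * x)].

Definition ideal_gen (A : set R) : set R := smallest ideal A.

Definition fin_gen I := exists s : seq R, I = ideal_gen [set` s].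

Definition principal I := exists a : R, I = ideal_gen [set a].

Definition prime_ideal P :=
  [/\ ideal P, ~ P 1 & forall x y, P (x * y) -> P x \/ P y].

Definition maximal_ideal M :=
  [/\ ideal M, ~ M 1 & forall I, ideal I -> M `<=` I -> I = M \/ I = setT].

Definition semilocal := finite_set [set M | maximal_ideal M].

Definition divided P :=
  prime_ideal P /\ forall I, ideal I -> I `<=` P \/ P `<=` I.

Definition nilrad : set R := [set x | exists n : nat, x ^+ n = 0].

Definition zerodiv : set R := [set x | exists2 y, y != 0 & x * y = 0].

Definition nonnil I := ideal I /\ ~ (I `<=` nilrad).

Definition phi_ring := divided nilrad.

End Ideals.

Arguments nilrad : clear implicits.
Arguments zerodiv : clear implicits.
Arguments semilocal : clear implicits.
Arguments phi_ring : clear implicits.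

(* [~ S 0] makes the localization a nonzero ring. *)
Record mulset (R : comNzRingType) := MulSet {
  mulset_set :> set R;
  mulset0 : ~ mulset_set 0;
  mulset1 : mulset_set 1;
  mulsetM : forall x y, mulset_set x -> mulset_set y -> mulset_set (x * y) }.

Section MulSets.
Variable R : comNzRingType.

Lemma prime_compl0 (P : set R) (hP : prime_ideal P) : ~ (~` P) 0.
Proof. by case: hP => [[P0 _ _] _ _]; apply. Qed.

Lemma prime_compl1 (P : set R) (hP : prime_ideal P) : (~` P) 1.
Proof. by case: hP. Qed.

Lemma prime_complM (P : set R) (hP : prime_ideal P) (x y : R) :
  (~` P) x -> (~` P) y -> (~` P) (x * y).
Proof. by case: hP => _ _ PM Px Py /PM[]. Qed.

Definition prime_compl (P : set R) (hP : prime_ideal P) : mulset R :=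
  MulSet (prime_compl0 hP) (prime_compl1 hP) (@prime_complM P hP).

Lemma regular0 : ~ (~` zerodiv R) 0.
Proof. by apply; exists 1; rewrite ?oner_eq0 ?mul0r. Qed.

Lemma regular1 : (~` zerodiv R) 1.
Proof. by move=> [y y0]; rewrite mul1r => /eqP; rewrite (negPf y0). Qed.

Lemma regularM (x y : R) :
  (~` zerodiv R) x -> (~` zerodiv R) y -> (~` zerodiv R) (x * y).
Proof.
move=> hx hy [z z0 xyz]; have [yz|yz] := eqVneq (y * z) 0.
  by apply: hy; exists z.
by apply: hx; exists (y * z); rewrite // mulrA.
Qed.

Definition regular : mulset R := MulSet regular0 regular1 regularM.

End MulSets.

Arguments regular : clear implicits.

Section Localization.
Variables (R : comNzRingType) (S : mulset R).

Record prefrac := PreFrac { nd :> R * R; _ : nd.2 \in (S : set R) }.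

HB.instance Definition _ := [isSub for nd].
HB.instance Definition _ := [Choice of prefrac by <:].

Implicit Types x y z : prefrac.

Lemma prefrac_den x : (S : set R) x.2.
Proof. by case: x => [[n d] /=]; rewrite in_setE. Qed.

Definition mkfrac (n d : R) (Sd : (S : set R) d) : prefrac :=
  @PreFrac (n, d) (mem_set Sd).

Definition equivl x y : bool :=
  `[< exists2 u, (S : set R) u & u * (x.1 * y.2) = u * (y.1 * x.2) >].

Lemma equivlP x y :
  reflect (exists2 u, (S : set R) u & u * (x.1 * y.2) = u * (y.1 * x.2))
          (equivl x y).
Proof. exact: asboolP. Qed.

Lemma equivl_refl : reflexive equivl.
Proof. by move=> x; apply/equivlP; exists 1; [exact: mulset1|]. Qed.

Lemma equivl_sym : symmetric equivl.
Proof. by move=> x y; apply/equivlP/equivlP => -[u Su e]; exists u. Qed.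

Lemma equivl_trans : transitive equivl.
Proof.
move=> y x z /equivlP[u Su e] /equivlP[v Sv f]; apply/equivlP.
exists (u * v * y.2).
  by apply: mulsetM; [exact: mulsetM | exact: prefrac_den].
transitivity (v * z.2 * (u * (x.1 * y.2))); first by ring.
rewrite e; transitivity (u * x.2 * (v * (y.1 * z.2))); first by ring.
by rewrite f; ring.
Qed.

Canonical equivl_equiv := EquivRel equivl equivl_refl equivl_sym equivl_trans.

Definition loc := {eq_quot equivl}.

HB.instance Definition _ : EqQuotient _ equivl loc := EqQuotient.on loc.
HB.instance Definition _ := Choice.on loc.

Definition loc_frac (n d : R) (Sd : (S : set R) d) : loc := \pi_loc (mkfrac n Sd).

Lemma eq_loc_frac x y :
  reflect (exists2 u, (S : set R) u & u * (x.1 * y.2) = u * (y.1 * x.2))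
          (\pi_loc x == \pi_loc y).
Proof. by rewrite eqmodE; exact: equivlP. Qed.

Lemma pi_loc_eq x y (u : R) : (S : set R) u ->
  u * (x.1 * y.2) = u * (y.1 * x.2) -> \pi_loc x = \pi_loc y.
Proof. by move=> Su e; apply/eqP/eq_loc_frac; exists u. Qed.

Lemma repr_loc x : exists2 u, (S : set R) u &
  u * ((repr (\pi_loc x)).1 * x.2) = u * (x.1 * (repr (\pi_loc x)).2).
Proof. by apply/eq_loc_frac; rewrite reprK. Qed.

Definition addl x y : prefrac :=
  mkfrac (x.1 * y.2 + y.1 * x.2) (mulsetM (prefrac_den x) (prefrac_den y)).
Definition loc_add := lift_op2 loc addl.

Lemma pi_loc_add : {morph \pi : x y / addl x y >-> loc_add x y}.
Proof.
move=> x y; unlock loc_add; apply/esym.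
have [u Su e] := repr_loc x; have [v Sv f] := repr_loc y.
apply: (@pi_loc_eq _ _ (u * v)); first exact: mulsetM.
move: (repr (\pi_loc x)) (repr (\pi_loc y)) e f => x' y' e f; rewrite /addl /=.
transitivity (v * y'.2 * y.2 * (u * (x'.1 * x.2))
            + u * x'.2 * x.2 * (v * (y'.1 * y.2))); first by ring.
by rewrite e f; ring.
Qed.
Canonical pi_loc_add_morph := PiMorph2 pi_loc_add.

Definition oppl x : prefrac := mkfrac (- x.1) (prefrac_den x).
Definition loc_opp := lift_op1 loc oppl.

Lemma pi_loc_opp : {morph \pi : x / oppl x >-> loc_opp x}.
Proof.
move=> x; unlock loc_opp; apply/esym; have [u Su e] := repr_loc x.
by apply: (pi_loc_eq Su); rewrite /= !mulNr !mulrN e.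
Qed.
Canonical pi_loc_opp_morph := PiMorph1 pi_loc_opp.

Definition mull x y : prefrac :=
  mkfrac (x.1 * y.1) (mulsetM (prefrac_den x) (prefrac_den y)).
Definition loc_mul := lift_op2 loc mull.

Lemma pi_loc_mul : {morph \pi : x y / mull x y >-> loc_mul x y}.
Proof.
move=> x y; unlock loc_mul; apply/esym.
have [u Su e] := repr_loc x; have [v Sv f] := repr_loc y.
apply: (@pi_loc_eq _ _ (u * v)); first exact: mulsetM.
move: (repr (\pi_loc x)) (repr (\pi_loc y)) e f => x' y' e f; rewrite /mull /=.
transitivity ((u * (x'.1 * x.2)) * (v * (y'.1 * y.2))); first by ring.
by rewrite e f; ring.
Qed.
Canonical pi_loc_mul_morph := PiMorph2 pi_loc_mul.

Definition to_loc : R -> loc :=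
  lift_embed loc (fun a : R => mkfrac a (mulset1 S)).
Canonical to_loc_pi_morph := PiEmbed to_loc.

Lemma loc_addA : associative loc_add.
Proof.
elim/quotW=> x; elim/quotW=> y; elim/quotW=> z; rewrite !piE.
by apply: (pi_loc_eq (mulset1 S)) => /=; ring.
Qed.

Lemma loc_addC : commutative loc_add.
Proof.
elim/quotW=> x; elim/quotW=> y; rewrite !piE.
by apply: (pi_loc_eq (mulset1 S)) => /=; ring.
Qed.

Lemma loc_add0 : left_id (to_loc 0) loc_add.
Proof.
elim/quotW=> x; rewrite !piE.
by apply: (pi_loc_eq (mulset1 S)) => /=; ring.
Qed.

Lemma loc_addN : left_inverse (to_loc 0) loc_opp loc_add.
Proof.
elim/quotW=> x; rewrite !piE.
by apply: (pi_loc_eq (mulset1 S)) => /=; ring.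
Qed.

HB.instance Definition _ :=
  GRing.isZmodule.Build loc loc_addA loc_addC loc_add0 loc_addN.

Lemma loc_mulA : associative loc_mul.
Proof.
elim/quotW=> x; elim/quotW=> y; elim/quotW=> z; rewrite !piE.
by apply: (pi_loc_eq (mulset1 S)) => /=; ring.
Qed.

Lemma loc_mulC : commutative loc_mul.
Proof.
elim/quotW=> x; elim/quotW=> y; rewrite !piE.
by apply: (pi_loc_eq (mulset1 S)) => /=; ring.
Qed.

Lemma loc_mul1 : left_id (to_loc 1) loc_mul.
Proof.
elim/quotW=> x; rewrite !piE.
by apply: (pi_loc_eq (mulset1 S)) => /=; ring.
Qed.

Lemma loc_mulDl : left_distributive loc_mul loc_add.
Proof.
elim/quotW=> x; elim/quotW=> y; elim/quotW=> z; rewrite !piE.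
by apply: (pi_loc_eq (mulset1 S)) => /=; ring.
Qed.

Lemma loc_one_neq0 : to_loc 1 != to_loc 0.
Proof.
rewrite !piE; apply/negP => /equivlP[u Su] /=.
by rewrite mul0r mulr0 !mulr1 => u0; apply: (mulset0 (m := S)); rewrite -u0.
Qed.

HB.instance Definition _ := GRing.Zmodule_isComNzRing.Build loc
  loc_mulA loc_mulC loc_mul1 loc_mulDl loc_one_neq0.

Lemma to_loc_zmod_morphism : zmod_morphism to_loc.
Proof.
move=> a b; change (to_loc (a - b) = loc_add (to_loc a) (loc_opp (to_loc b))).
by rewrite !piE; apply: (pi_loc_eq (mulset1 S)) => /=; ring.
Qed.

HB.instance Definition _ :=
  GRing.isZmodMorphism.Build R loc to_loc to_loc_zmod_morphism.

Lemma to_loc_monoid_morphism : monoid_morphism to_loc.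
Proof.
split=> // a b; change (to_loc (a * b) = loc_mul (to_loc a) (to_loc b)).
by rewrite !piE; apply: (pi_loc_eq (mulset1 S)) => /=; ring.
Qed.

HB.instance Definition _ :=
  GRing.isMonoidMorphism.Build R loc to_loc to_loc_monoid_morphism.

Lemma to_loc_eqP (a b : R) :
  to_loc a = to_loc b <-> exists2 u, (S : set R) u & u * a = u * b.
Proof.
split=> [/eqP|[u Su e]].
  by rewrite !piE => /equivlP[u Su] /=; rewrite !mulr1 => e; exists u.
by rewrite !piE; apply: (pi_loc_eq Su) => /=; rewrite !mulr1.
Qed.

Lemma loc_frac_den (n d : R) (Sd : (S : set R) d) :
  loc_frac n Sd * to_loc d = to_loc n.
Proof.
change (loc_mul (loc_frac n Sd) (to_loc d) = to_loc n).
by rewrite /loc_frac !piE; apply: (pi_loc_eq (mulset1 S)) => /=; ring.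
Qed.

Lemma loc_fracP (x : loc) : exists n d (Sd : (S : set R) d), x = loc_frac n Sd.
Proof.
elim/quotW: x => x; exists x.1, x.2, (prefrac_den x).
by apply: (pi_loc_eq (mulset1 S)) => /=; ring.
Qed.

End Localization.

Arguments loc_frac {R} S n d Sd.
Arguments to_loc {R} S.

Definition total_quotient (R : comNzRingType) := loc (regular R).

HB.instance Definition _ (R : comNzRingType) :=
  GRing.ComNzRing.on (total_quotient R).

Definition to_tq (R : comNzRingType) : {rmorphism R -> total_quotient R} :=
  to_loc (regular R).

Section Invertible.
Variable R : comNzRingType.
Implicit Types (I : set R) (A B : set (total_quotient R)).

(* The R-submodule of T(R) generated by products is the set of finite sums of   *)
(* products when A and B are themselves R-submodules.                           *)
Definition prod_set A B : set (total_quotient R) :=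
  [set z | exists s : seq (total_quotient R * total_quotient R),
     (forall p, p \in s -> A p.1 /\ B p.2) /\ z = \sum_(p <- s) p.1 * p.2].

Definition inv_ideal I : set (total_quotient R) :=
  [set x | forall a, I a -> range (@to_tq R) (x * to_tq R a)].

Definition invertible I :=
  prod_set (@to_tq R @` I) (inv_ideal I) = range (@to_tq R).

End Invertible.

Section RingImage.
Variables (R L : comNzRingType) (f : {rmorphism R -> L}).

Definition in_rimage : {pred L} := fun y => y \in range f.

Record rimage := RImage { rimage_val :> L; _ : rimage_val \in in_rimage }.

HB.instance Definition _ := [isSub for rimage_val].
HB.instance Definition _ := [Choice of rimage by <:].

Lemma rimage_subring_closed : subring_closed in_rimage.
Proof.
split=> [|x y|x y]; rewrite -!topredE /= /in_rimage ?in_setE.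
- by exists 1; rewrite ?rmorph1.
- by move=> [a _ <-] [b _ <-]; exists (a - b); rewrite ?rmorphB.
- by move=> [a _ <-] [b _ <-]; exists (a * b); rewrite ?rmorphM.
Qed.

HB.instance Definition _ :=
  GRing.isSubringClosed.Build L in_rimage rimage_subring_closed.
HB.instance Definition _ := [SubChoice_isSubComNzRing of rimage by <:].

End RingImage.

Section Phi.
Variables (R : comNzRingType) (hR : phi_ring R).

Definition loc_nil := loc (prime_compl (proj1 hR)).

HB.instance Definition _ := GRing.ComNzRing.on loc_nil.

Definition to_loc_nil : {rmorphism R -> loc_nil} :=
  to_loc (prime_compl (proj1 hR)).

(* The ring phi(R) is the subring of R_Nil(R) on which the corestriction [phi]  *)
(* below lands.                                                                 *)
Definition phiR := rimage to_loc_nil.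

HB.instance Definition _ := GRing.ComNzRing.on phiR.

Definition phi (a : R) : phiR := RImage (mem_set (imageT to_loc_nil a)).

Lemma phi_zmod_morphism : zmod_morphism phi.
Proof. by move=> a b; apply: val_inj; rewrite /= rmorphB. Qed.

HB.instance Definition _ :=
  GRing.isZmodMorphism.Build R phiR phi phi_zmod_morphism.

Lemma phi_monoid_morphism : monoid_morphism phi.
Proof.
by split=> [|a b]; apply: val_inj; rewrite /= ?rmorph1 ?rmorphM.
Qed.

HB.instance Definition _ :=
  GRing.isMonoidMorphism.Build R phiR phi phi_monoid_morphism.

Definition phi_invertible (I : set R) := nonnil I /\ invertible (phi @` I).

Definition phi_prufer :=
  forall I : set R, fin_gen I -> nonnil I -> phi_invertible I.

Definition phi_bezout :=
  forall I : set R, fin_gen I -> nonnil I -> principal (phi @` I).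

End Phi.

Arguments phi_prufer {R} hR.
Arguments phi_bezout {R} hR.

(* Main.v *)
Require Import Defs.
From mathcomp Require Import all_boot all_order all_algebra.
From mathcomp Require Import all_classical.

(** The ring [phi(R)] is a surjective image of [R], so it has only finitely
    many maximal ideals, and the Prüfer hypothesis makes [phi(I)] invertible in
    it.  Everything therefore reduces to the classical fact that an invertible
    ideal [J] of a semilocal ring is principal ([invertible_principal]).

    If some [v] in the inverse of [J] satisfies [v J = R], then [v x = 1] for
    some [x] in [J], and every [a] in [J] is [(v a) x], a multiple of [x].
    Since [v J] is an ideal of [R], it is enough that it escapes every maximal
    ideal.  For a single [M] this is easy: [J J^-1] contains [1], so some
    [b a] lies outside [M].  Multiplying [b] by an element that lies in all the
    other maximal ideals but not in [M] yields [b_M] with [b_M J] contained in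
    each [N <> M] ([local_witness]).  Finiteness enters twice: it provides that
    multiplier as a finite product ([separating_element]), and it allows one to
    take for [v] the sum of all the [b_M], of which only the term [b_M] matters
    modulo [M]. *)

Set Implicit Arguments.
Unset Strict Implicit.
Unset Printing Implicit Defensive.

Import GRing.Theory.
Local Open Scope classical_set_scope.
Local Open Scope ring_scope.

Section MaximalIdeals.
Variable R : comNzRingType.
Implicit Types I M N : set R.

Lemma maximal_prime M : maximal_ideal M -> prime_ideal M.
Proof.
move=> [Mid M1 Mmax]; case: (Mid) => M0 MD MM; split=> // x y Mxy.
apply: contrapT => /not_orP[Mx My].
pose K := [set z | exists2 m, M m & exists r, z = m + r * x].
have Kid : ideal K.
  split.
  - by exists 0 => //; exists 0; rewrite mul0r addr0.
  - move=> _ _ [m Mm [r ->]] [n Mn [s ->]]; exists (m + n); first exact: MD.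
    by exists (r + s); rewrite mulrDl addrACA.
  - move=> a _ [m Mm [r ->]]; exists (a * m); first exact: MM.
    by exists (a * r); rewrite mulrDr mulrA.
have MK : M `<=` K by move=> m Mm; exists m => //; exists 0; rewrite mul0r addr0.
have [KM|KT] := Mmax K Kid MK.
  by apply: Mx; rewrite -KM; exists 0 => //; exists 1; rewrite mul1r add0r.
have [m Mm [r e]] : K 1 by rewrite KT.
apply: My; rewrite -[y]mul1r e mulrDl -mulrA mulrC.
by apply: (MD); apply: (MM).
Qed.

(** Zorn's lemma for unions of chains also asks for the empty chain, whose
    union is empty: the chains are therefore made of sets [X] for which
    [I `|` X], rather than [X], is a proper ideal. *)
Lemma proper_sub_maximal I :
  ideal I -> ~ I 1 -> exists2 M, maximal_ideal M & I `<=` M.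
Proof.
move=> Iid I1.
pose P X := ideal (I `|` X) /\ ~ (I `|` X) 1.
have [F FP Ftot|A [[Aid A1] Amax]] := @Zorn_bigcup R P.
  have lift X z : F X -> (I `|` X) z -> (I `|` \bigcup_(Y in F) Y) z.
    by move=> FX [Iz|Xz]; [left|right; exists X].
  have lub x y : (I `|` \bigcup_(Y in F) Y) x ->
      (I `|` \bigcup_(Y in F) Y) y ->
      (I x /\ I y) \/ exists X, [/\ F X, (I `|` X) x & (I `|` X) y].
    move=> [Ix|[X FX Xx]] [Iy|[Y FY Yy]]; first by left.
    - by right; exists Y; split=> //; [left|right].
    - by right; exists X; split=> //; [right|left].
    - by right; have [XY|YX] := Ftot _ _ FX FY;
        [exists Y; split=> //; right; [exact: XY|]
        |exists X; split=> //; right; [|exact: YX]].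
  split; last by move=> [//|[X FX X1]]; have [_] := FP _ FX; apply; right.
  have [I0 ID IM] := Iid; split; first by left.
  - move=> x y Ux Uy; have [[Ix Iy]|[X [FX Xx Xy]]] := lub x y Ux Uy.
      by left; exact: ID.
    by apply: (lift X) => //; have [[_ XD _] _] := FP _ FX; exact: XD.
  - move=> a x [Ix|[X FX Xx]]; first by left; exact: IM.
    apply: (lift X) => //; have [[_ _ XM] _] := FP _ FX.
    by apply: XM; right.
exists (I `|` A); last by move=> x; left.
split=> // K Kid AK; have [K1|K1] := EM (K 1).
  right; apply/seteqP; split=> // x _; rewrite -[x]mulr1.
  by have [_ _ KM] := Kid; exact: KM.
left; apply/seteqP; split=> // x Kx; apply: contrapT => Ax.
have IK : I `|` K = K by apply/setUidPr => y Iy; apply: AK; left.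
apply: (Amax K); last by rewrite /P IK.
split; first by move=> y Ay; apply: AK; right.
by move=> KA; apply: Ax; right; exact: KA.
Qed.

(** Distinct maximal ideals are incomparable, so each [N <> M] contains an
    element outside [M]; the product of these elements stays outside [M]
    because [M] is prime. *)
Lemma separating_element (s : seq (set R)) M :
  maximal_ideal M -> (forall N, N \in s -> maximal_ideal N) ->
  exists2 u, ~ M u & forall N, N \in s -> N != M -> N u.
Proof.
move=> Mmax smax; have [_ M1 MP] := maximal_prime Mmax.
elim: s smax => [|N s IH] smax; first by exists 1.
have [|u Mu su] := IH; first by move=> K Ks; apply: smax; rewrite inE Ks orbT.
have [NM|NM] := eqVneq N M.
  by exists u => // K; rewrite inE => /orP[/eqP ->|/su//]; rewrite NM eqxx.
have Nmax : maximal_ideal N by apply: smax; rewrite mem_head.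
have [w Nw Mw] : exists2 w, N w & ~ M w.
  apply: contrapT => h; have [Nid N1 Nm] := Nmax; have [Mid _ _] := Mmax.
  have NsM : N `<=` M.
    by move=> w Nw; apply: contrapT => Mw; apply: h; exists w.
  have [e|e] := Nm M Mid NsM; first by rewrite e eqxx in NM.
  by apply: M1; rewrite e.
exists (u * w); first by move=> /MP[].
move=> K; rewrite inE => /orP[/eqP -> _|Ks KM].
  by have [[_ _ NN] _ _] := Nmax; exact: NN.
have [|[_ _ KK] _ _] := smax K; first by rewrite inE Ks orbT.
by rewrite mulrC; apply: KK; exact: su.
Qed.

End MaximalIdeals.

Section InvertibleIdeals.
Variable R : comNzRingType.
Implicit Types (J M N : set R) (b : total_quotient R).

Lemma to_tq_inj : injective (@to_tq R).
Proof.
move=> x y /to_loc_eqP[u Su e]; apply/eqP; rewrite -subr_eq0; apply/eqP.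
apply: contrapT => /eqP xy; apply: Su; exists (x - y) => //.
by rewrite mulrBr e subrr.
Qed.

Lemma inv_idealD J b1 b2 :
  inv_ideal J b1 -> inv_ideal J b2 -> inv_ideal J (b1 + b2).
Proof.
move=> h1 h2 a Ja; have [c1 _ e1] := h1 a Ja; have [c2 _ e2] := h2 a Ja.
by exists (c1 + c2) => //; rewrite rmorphD mulrDl e1 e2.
Qed.

(** The last clause is what makes witnesses for different maximal ideals
    addable: the summand built for [M] is invisible modulo every other [N], so
    the summands cannot cancel each other. *)
Lemma local_witness J (s : seq (set R)) M :
  ideal J -> invertible J ->
  maximal_ideal M -> (forall N, N \in s -> maximal_ideal N) ->
  exists b, [/\ inv_ideal J b,
    exists a c, [/\ J a, b * to_tq R a = to_tq R c & ~ M c] &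
    forall N a c, N \in s -> N != M -> J a ->
      b * to_tq R a = to_tq R c -> N c].
Proof.
move=> Jid Jinv Mmax smax.
have [[M0 MD MM] M1 MP] := maximal_prime Mmax.
have [b Jb [a [c [Ja bac Mc]]]] : exists2 b, inv_ideal J b &
    exists a c, [/\ J a, b * to_tq R a = to_tq R c & ~ M c].
  have : range (@to_tq R) 1 by exists 1; rewrite ?rmorph1.
  rewrite -Jinv => -[r [rJ e1]]; apply: contrapT => h.
  (* otherwise each product, hence 1, comes from M *)
  have [c Mc ec] : (to_tq R @` M) (\sum_(p <- r) p.1 * p.2).
    rewrite big_seq; apply: (@big_ind _ (to_tq R @` M)).
    - by exists 0; rewrite ?rmorph0.
    - by move=> _ _ [x Mx <-] [y My <-]; exists (x + y);
        [exact: MD|rewrite rmorphD].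
    - move=> p /rJ[[a Ja <-] Jp]; have [c _ e] := Jp a Ja.
      exists c; last by rewrite e mulrC.
      apply: contrapT => Mc; apply: h; exists p.2 => //.
      by exists a, c.
  by apply: M1; rewrite -(_ : c = 1) //; apply: to_tq_inj; rewrite ec -e1 rmorph1.
have [u Mu su] := separating_element Mmax smax.
exists (to_tq R u * b); split.
- move=> a' Ja'; have [d _ e] := Jb a' Ja'; exists (u * d) => //.
  by rewrite rmorphM e mulrA.
- exists a, (u * c); split=> //; first by rewrite -mulrA bac rmorphM.
  by move=> /MP[].
- move=> N a' c' Ns NM Ja'; rewrite -mulrA; have [d _ <-] := Jb a' Ja'.
  rewrite -rmorphM => /to_tq_inj <-.
  have [[_ _ NN] _ _] := smax N Ns; rewrite mulrC; apply: NN; exact: su.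
Qed.

(** A generator is the element [x] of [J] with [v x = 1], where [v] is the sum
    of the local witnesses. *)
Theorem invertible_principal J :
  semilocal R -> ideal J -> invertible J -> principal J.
Proof.
move=> /finite_seqP[s0 es0] Jid Jinv.
pose s := undup s0.
have smax N : N \in s -> maximal_ideal N.
  rewrite mem_undup => Ns; have : [set` s0] N by [].
  by rewrite -es0.
have maxs N : maximal_ideal N -> N \in s.
  move=> Nmax; rewrite mem_undup; have : [set M | maximal_ideal M] N by [].
  by rewrite es0.
have /choice[b bP] : forall M, exists b, M \in s ->
    [/\ inv_ideal J b,
      exists a c, [/\ J a, b * to_tq R a = to_tq R c & ~ M c] &
      forall N a c, N \in s -> N != M -> J a ->
        b * to_tq R a = to_tq R c -> N c].
  move=> M; have [Ms|] := boolP (M \in s); last by exists 0.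
  by have [b hb] := local_witness Jid Jinv (smax M Ms) smax; exists b.
pose v := \sum_(M <- s) b M.
have Jv : inv_ideal J v.
  rewrite /v big_seq; apply: big_ind; last by move=> M /bP[].
  - by move=> a _; exists 0; rewrite ?rmorph0 ?mul0r.
  - by move=> *; apply: inv_idealD.
have [J0 JD JM] := Jid.
pose K := [set c | exists2 a, J a & v * to_tq R a = to_tq R c].
have Kid : ideal K.
  split; first by exists 0; rewrite ?rmorph0 ?mulr0.
  - move=> x y [a Ja ea] [a' Ja' ea']; exists (a + a'); first exact: JD.
    by rewrite !rmorphD mulrDr ea ea'.
  - move=> r x [a Ja ea]; exists (r * a); first exact: JM.
    by rewrite !rmorphM mulrCA ea.
have [x Jx vx] : K 1.
  apply: contrapT => /(proper_sub_maximal Kid)[M Mmax KM].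
  have Ms := maxs _ Mmax; have [_ [a [c [Ja bac Mc]]] _] := bP M Ms.
  have [d _ ed] := Jv a Ja.
  have Md : M d by apply: KM; exists a.
  have [Mid _ _] := Mmax; have [M0 MD MM] := Mid.
  (* modulo M only the summand b M of v contributes to v * a *)
  have [m Mm em] : (to_tq R @` M) (\sum_(N <- s | N != M) b N * to_tq R a).
    rewrite big_seq_cond; apply: (@big_ind _ (to_tq R @` M)).
    - by exists 0; rewrite ?rmorph0.
    - by move=> _ _ [y My <-] [z Mz <-]; exists (y + z);
        [exact: MD|rewrite rmorphD].
    - move=> N /andP[Ns NM]; have [JN _ NP] := bP N Ns.
      have [e _ ee] := JN a Ja; exists e => //.
      by apply: (NP M a) => //; rewrite eq_sym.
  apply: Mc; rewrite (_ : c = d + (-1) * m); first by apply: MD => //; exact: MM.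
  rewrite mulN1r; apply/eqP; rewrite eq_sym subr_eq; apply/eqP.
  apply: to_tq_inj; rewrite rmorphD ed em /v mulr_suml.
  by rewrite (bigD1_seq M) ?undup_uniq //= bac.
exists x; apply/seteqP; split.
  move=> a Ja K' [K'id K'x]; have [c _ ec] := Jv a Ja.
  rewrite (_ : a = c * x).
    by have [_ _ K'M] := K'id; apply: K'M; exact: K'x.
  apply: to_tq_inj; rewrite rmorphM ec mulrAC vx.
  by rewrite rmorph1 mul1r.
by move=> y; apply; split=> // _ ->.
Qed.

End InvertibleIdeals.

Section SurjectiveImage.
Variables (R L : comNzRingType) (f : {rmorphism R -> L}).
Hypothesis f_surj : forall y, exists x, f x = y.

Lemma ideal_image (I : set R) : ideal I -> ideal (f @` I).
Proof.
move=> [I0 ID IM]; split; first by exists 0; rewrite ?rmorph0.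
- by move=> _ _ [x Ix <-] [y Iy <-]; exists (x + y);
    [exact: ID|rewrite rmorphD].
- move=> a _ [x Ix <-]; have [r <-] := f_surj a.
  by exists (r * x); [exact: IM|rewrite rmorphM].
Qed.

Lemma image_preimage_surj (N : set L) : f @` (f @^-1` N) = N.
Proof.
apply/seteqP; split=> [_ [x Nx <-]//|y Ny].
by have [x e] := f_surj y; exists x; rewrite //= e.
Qed.

(** Ideals of [R] above [f @^-1` N] contain the kernel of [f], and so are
    determined by their images, which are ideals of [L] above [N]. *)
Lemma maximal_preimage (N : set L) :
  maximal_ideal N -> maximal_ideal (f @^-1` N).
Proof.
move=> [[N0 ND NM] N1 Nmax]; split.
- split; first by rewrite /= rmorph0.
  + by move=> x y /= Nx Ny; rewrite rmorphD; exact: ND.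
  + by move=> a x /= Nx; rewrite rmorphM; exact: NM.
- by rewrite /= rmorph1.
move=> K Kid NK; have [_ KD _] := Kid.
have satK x : (f @` K) (f x) -> K x.
  move=> [k Kk e]; rewrite -[x](subrK k); apply: KD => //; apply: NK.
  by rewrite /= rmorphB e subrr.
have NfK : N `<=` f @` K.
  by rewrite -{1}(image_preimage_surj N); exact: image_subset.
have [e|e] := Nmax _ (ideal_image Kid) NfK.
  by left; apply/seteqP; split=> // x Kx /=; rewrite -e; exists x.
by right; apply/seteqP; split=> // x _; apply: satK; rewrite e.
Qed.

Lemma semilocal_image : semilocal R -> semilocal L.
Proof.
move=> /(finite_image (fun M : set R => f @` M)); apply: sub_finite_set.
move=> N Nmax; exists (f @^-1` N); first exact: maximal_preimage.
exact: image_preimage_surj.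
Qed.

End SurjectiveImage.

Lemma phi_surj (R : comNzRingType) (hR : phi_ring R) (y : phiR hR) :
  exists x, phi hR x = y.
Proof.
case: y => y yf; have := yf; rewrite /in_rimage in_setE => -[x _ e].
by exists x; apply: val_inj.
Qed.

Theorem theorem2p14 (R : comNzRingType) (hR : phi_ring R) :
  semilocal R -> phi_prufer hR -> phi_bezout hR.
Proof.
move=> Rsl Rpr I Ifg Inn; have [_ Iinv] := Rpr I Ifg Inn.
apply: invertible_principal Iinv.
  exact: (semilocal_image (@phi_surj R hR)).
by apply: (ideal_image (@phi_surj R hR)); case: Inn.
Qed.
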